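(* Let $T\ge1$ and suppose that $\boldsymbol{\Phi}_{uy}=\sum_{t=0}^T U_t z^{-t}$ and $\boldsymbol{\Phi}_{yy}=\sum_{t=0}^T Y_t z^{-t}$ are FIR transfer matrices with horizon $T$ ($U_t\in\mathbb{R}^{m\times p}$, $Y_t\in\mathbb{R}^{p\times p}$) that are part of a solution of the affine constraints of either the input-output parameterization or the Mixed I parameterization (recalled in the context). Then a state-space realization for the output feedback controller $\mathbf{K}=\boldsymbol{\Phi}_{uy}\boldsymbol{\Phi}_{yy}^{-1}$ is $$\mathbf{K}=\left[\begin{array}{c|c} Z_p-\mathcal{I}_p\hat{Y} & -\mathcal{I}_p\\ \hline U_0\hat{Y}-\hat{U} & U_0\end{array}\right],$$ where $\hat U=\begin{bmatrix}U_1&U_2&\cdots&U_T\end{bmatrix}\in\mathbb{R}^{m\times pT}$, $\hat Y=\begin{bmatrix}Y_1&Y_2&\cdots&Y_T\end{bmatrix}\in\mathbb{R}^{p\times pT}$, $Z_p\in\mathbb{R}^{pT\times pT}$ is the block down-shift matrix and $\mathcal{I}_p=[I_p,0,\ldots,0]^{\mathsf T}\in\mathbb{R}^{pT\times p}$.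
   Context: The notation $\left[\begin{array}{c|c}\mathcal A&\mathcal B\\ \hline \mathcal C&\mathcal D\end{array}\right]$ denotes the transfer matrix $\mathcal C(zI-\mathcal A)^{-1}\mathcal B+\mathcal D$. $Z_p$ is the $T\times T$ block matrix with $p\times p$ blocks whose first block sub-diagonal consists of identity matrices $I_p$ and whose other blocks are zero. $\mathbf{G}=C(zI-A)^{-1}B$ is a strictly proper plant with $m$ inputs and $p$ outputs; $\mathcal{RH}_\infty$ is the set of real-rational proper stable transfer matrices (poles of modulus $<1$). Input-output parameterization constraints: there are $\boldsymbol{\Phi}_{yu},\boldsymbol{\Phi}_{uu}\in\mathcal{RH}_\infty$ with $\begin{bmatrix}I&-\mathbf{G}\end{bmatrix}\begin{bmatrix}\boldsymbol{\Phi}_{yy}&\boldsymbol{\Phi}_{yu}\\ \boldsymbol{\Phi}_{uy}&\boldsymbol{\Phi}_{uu}\end{bmatrix}=\begin{bmatrix}I&0\end{bmatrix}$, $\begin{bmatrix}\boldsymbol{\Phi}_{yy}&\boldsymbol{\Phi}_{yu}\\ \boldsymbol{\Phi}_{uy}&\boldsymbol{\Phi}_{uu}\end{bmatrix}\begin{bmatrix}-\mathbf{G}\\ I\end{bmatrix}=\begin{bmatrix}0\\ I\end{bmatrix}$. Mixed I constraints: there are $\boldsymbol{\Phi}_{yx},\boldsymbol{\Phi}_{ux}\in\mathcal{RH}_\infty$ with $\begin{bmatrix}I&-\mathbf{G}\end{bmatrix}\begin{bmatrix}\boldsymbol{\Phi}_{yx}&\boldsymbol{\Phi}_{yy}\\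 \boldsymbol{\Phi}_{ux}&\boldsymbol{\Phi}_{uy}\end{bmatrix}=\begin{bmatrix}C(zI-A)^{-1}&I\end{bmatrix}$, $\begin{bmatrix}\boldsymbol{\Phi}_{yx}&\boldsymbol{\Phi}_{yy}\\ \boldsymbol{\Phi}_{ux}&\boldsymbol{\Phi}_{uy}\end{bmatrix}\begin{bmatrix}zI-A\\ -C\end{bmatrix}=0$. *)

(* Defs.v *)
(* MathComp, with the real numbers as an arbitrary [R : realType] from
   MathComp-Analysis.  Transfer matrices are matrices over the field
   {fraction {poly R}} of real rational functions in the indeterminate z. *)
From mathcomp Require Import all_boot all_order all_algebra.
From mathcomp Require Import reals complex.

Set Implicit Arguments.
Unset Strict Implicit.
Unset Printing Implicit Defensive.

Import Order.TTheory GRing.Theory Num.Theory.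
Local Open Scope ring_scope.

Notation ratfun R := {fraction {poly R}}.
Notation "p %:F" := (@FracField.tofrac _ p) : ring_scope.

Definition zvar (R : realType) : ratfun R := 'X%:F.

Definition const_mat (R : realType) (m n : nat) (M : 'M[R]_(m, n)) :
  'M[ratfun R]_(m, n) := map_mx (@FracField.tofrac _ \o polyC) M.

(* zI - A.  It is always invertible over the rational functions, its
   determinant being the characteristic polynomial of A. *)
Definition pencil (R : realType) (n : nat) (A : 'M[R]_n) : 'M[ratfun R]_n :=
  (zvar R)%:M - const_mat A.

Definition transfer (R : realType) (n m p : nat) (A : 'M[R]_n)
    (B : 'M[R]_(n, m)) (C : 'M[R]_(p, n)) (D : 'M[R]_(p, m)) :
  'M[ratfun R]_(p, m) :=
  const_mat C *m invmx (pencil A) *m const_mat B + const_mat D.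

Definition proper_ratfun (R : realType) (f : ratfun R) : Prop :=
  exists num den : {poly R},
    [/\ den != 0, f = num%:F / den%:F
      & (size num <= size den)%N].

(* A finite pole is a complex root of the denominator of a reduced fraction;
   it does not depend on which reduced fraction is chosen. *)
Definition is_pole (R : realType) (f : ratfun R) (w : complex R) : Prop :=
  exists num den : {poly R},
    [/\ den != 0, coprimep num den,
        f = num%:F / den%:F
      & root (map_poly (real_complex R) den) w].

Definition stable_ratfun (R : realType) (f : ratfun R) : Prop :=
  forall w : complex R, is_pole f w -> `|w| < 1.

Definition RHinf (R : realType) (p m : nat) (F : 'M[ratfun R]_(p, m)) : Prop :=
  forall i j, proper_ratfun (F i j) /\ stable_ratfun (F i j).

Definition iop_constraints (R : realType) (p m : nat)
    (G : 'M[ratfun R]_(p, m))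
    (Phi_yy : 'M[ratfun R]_p) (Phi_uy : 'M[ratfun R]_(m, p)) : Prop :=
  exists (Phi_yu : 'M[ratfun R]_(p, m)) (Phi_uu : 'M[ratfun R]_m),
    [/\ RHinf Phi_yu, RHinf Phi_uu,
        row_mx 1%:M (- G) *m block_mx Phi_yy Phi_yu Phi_uy Phi_uu
          = row_mx 1%:M 0
      & block_mx Phi_yy Phi_yu Phi_uy Phi_uu *m col_mx (- G) 1%:M
          = col_mx 0 1%:M].

Definition mixed1_constraints (R : realType) (n p m : nat)
    (A : 'M[R]_n) (B : 'M[R]_(n, m)) (C : 'M[R]_(p, n))
    (Phi_yy : 'M[ratfun R]_p) (Phi_uy : 'M[ratfun R]_(m, p)) : Prop :=
  exists (Phi_yx : 'M[ratfun R]_(p, n)) (Phi_ux : 'M[ratfun R]_(m, n)),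
    [/\ RHinf Phi_yx, RHinf Phi_ux,
        row_mx 1%:M (- transfer A B C 0)
            *m block_mx Phi_yx Phi_yy Phi_ux Phi_uy
          = row_mx (const_mat C *m invmx (pencil A)) 1%:M
      & block_mx Phi_yx Phi_yy Phi_ux Phi_uy
            *m col_mx (pencil A) (- const_mat C)
          = 0].

Definition fir (R : realType) (T q p : nat) (F : 'I_T.+1 -> 'M[R]_(q, p)) :
  'M[ratfun R]_(q, p) :=
  \sum_(t < T.+1) zvar R ^- t *: const_mat (F t).

(* A dimension pT is written \sum_(t < T) p, the index type of MathComp's
   block matrices with T blocks of size p. *)

(* [F_1 F_2 ... F_T]: [lift ord0 t] is t + 1, so F_0 is left out. *)
Definition tail_row (R : realType) (T q p : nat)
    (F : 'I_T.+1 -> 'M[R]_(q, p)) : 'M[R]_(q, \sum_(t < T) p) :=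
  \mxrow_(t < T) F (lift ord0 t).

Definition block_downshift (R : realType) (T p : nat) :
  'M[R]_(\sum_(i < T) p, \sum_(j < T) p) :=
  \mxblock_(i < T, j < T) (if i == j.+1 :> nat then 1%:M else 0 : 'M[R]_p).

Definition block_e1 (R : realType) (T p : nat) : 'M[R]_(\sum_(i < T) p, p) :=
  \mxcol_(i < T) (if i == 0%N :> nat then 1%:M else 0 : 'M[R]_p).

(* Main.v *)
(* Let E be the first block column and V the block column z^-1 I, ..., z^-T I,
   so that (zI - Z_p) V = E, Phi_uy = U_0 + Uhat V and Phi_yy = Y_0 + Yhat V.
   Since G is strictly proper and Phi_uy is proper, the constraint
   Phi_yy - G Phi_uy = I forces Y_0 = I.  With M = zI - Z_p + E Yhat we get
   M V = E (I + Yhat V) = E Phi_yy, hence V = M^-1 E Phi_yy; both the inverse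
   I - Yhat M^-1 E of Phi_yy and the realization of K follow. *)
Require Import Defs.
From mathcomp Require Import all_boot all_order all_algebra.
From mathcomp Require Import reals complex.
From mathcomp Require Import perm zify.
Import Order.TTheory GRing.Theory Num.Theory.
Local Open Scope ring_scope.

(** * Degrees in the entries of the resolvent *)

Section Resolvent.
Context {R : realType}.

Lemma pencilE n (A : 'M[R]_n) :
  pencil A = map_mx (@FracField.tofrac _) (char_poly_mx A).
Proof.
by rewrite /pencil /const_mat /char_poly_mx map_mxB map_scalar_mx -map_mx_comp.
Qed.

Lemma det_pencil n (A : 'M[R]_n) : \det (pencil A) = (char_poly A)%:F.
Proof. by rewrite pencilE det_map_mx. Qed.

Lemma pencil_unit n (A : 'M[R]_n) : pencil A \in unitmx.
Proof.
by rewrite unitmxE det_pencil unitfE tofrac_eq0 monic_neq0 ?char_poly_monic.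
Qed.

(** Cramer's rule over the polynomials; it gives each entry as an explicit fraction whose sizes can
    be compared. *)
Lemma invmx_pencilE n (A : 'M[R]_n) i j :
  invmx (pencil A) i j =
  (cofactor (char_poly_mx A) j i)%:F / (char_poly A)%:F.
Proof.
rewrite /invmx pencil_unit !mxE det_pencil mulrC.
by rewrite pencilE cofactor_map_mx.
Qed.

Lemma size_char_poly_mx n (A : 'M[R]_n) i j : (size (char_poly_mx A i j) <= 2)%N.
Proof.
rewrite /char_poly_mx !mxE; apply: leq_trans (size_polyD _ _) _.
rewrite size_polyN geq_max; apply/andP; split.
  by case: (i == j); rewrite ?mulr1n ?mulr0n ?size_polyX ?size_poly0.
by apply: leq_trans (size_polyC_leq1 _) _.
Qed.

(** In the Leibniz expansion of the minor, each product has [n - 1] factors of degree at most 1. *)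
Lemma size_cofactor_char_poly_mx n (A : 'M[R]_n) i j :
  (size (cofactor (char_poly_mx A) i j) <= n)%N.
Proof.
rewrite /cofactor -signr_odd mulr_sign.
have sz_det : (size (\det (row' i (col' j (char_poly_mx A)))) <= n)%N.
  rewrite /determinant; apply: leq_trans (size_sum _ _ _) _.
  apply/bigmax_leqP => s _; rewrite mulr_sign; set P := \prod_(_ < _) _.
  have sz_prod : (size P <= n)%N.
    apply: leq_trans (size_poly_prod_leq _ _) _.
    rewrite leq_subLR card_ord.
    have : (\sum_(k < n.-1) size (row' i (col' j (char_poly_mx A)) k (s k))
             <= \sum_(k < n.-1) 2)%N.
      apply: leq_sum => k _; rewrite [row' _ _ _ _]mxE [col' _ _ _ _]mxE.
      exact: size_char_poly_mx.
    rewrite sum_nat_const card_ord -ltnS => /leq_trans; apply.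
    (* The index [i] makes [n] positive, so that [2 * n.-1 + 1 = n.-1 + n]. *)
    by have := ltn_ord i; lia.
  by case: ifP; rewrite ?size_polyN.
by case: ifP; rewrite ?size_polyN.
Qed.

End Resolvent.

(** * Order of vanishing at infinity *)

Section OrderAtInfinity.
Context {R : realType}.

(* Order 0 is properness and order 1 strict properness. *)
Definition order_at_infty_ge (k : nat) (f : ratfun R) : Prop :=
  exists num den : {poly R},
    [/\ den != 0, f = num%:F / den%:F & (size num + k <= size den)%N].

Lemma order_at_inftyW k l f :
  (l <= k)%N -> order_at_infty_ge k f -> order_at_infty_ge l f.
Proof.
by move=> lk [a [b [b0 -> le]]]; exists a, b; split => //; lia.
Qed.

Lemma order_at_infty0 k : order_at_infty_ge k 0.
Proof.
exists 0, 'X^k; rewrite size_poly0 size_polyXn tofrac0 mul0r -size_poly_eq0.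
by rewrite size_polyXn.
Qed.

Lemma order_at_inftyD k f g :
  order_at_infty_ge k f -> order_at_infty_ge k g -> order_at_infty_ge k (f + g).
Proof.
move=> [a [b [b0 -> ab]]] [c [d [d0 -> cd]]].
exists (a * d + c * b), (b * d); split; first by rewrite mulf_neq0.
  by rewrite tofracD !tofracM addf_div ?tofrac_eq0.
rewrite size_mul //; apply: leq_trans (leq_add (size_polyD _ _) (leqnn k)) _.
have bound x y w : (0 < y -> 0 < w -> x + k <= y -> (x + w).-1 + k <= (y + w).-1)%N.
  by lia.
rewrite addn_maxl geq_max; apply/andP; split.
  apply: leq_trans (leq_add (size_polyMleq _ _) (leqnn k)) _.
  by apply: bound ab; rewrite ?size_poly_gt0.
apply: leq_trans (leq_add (size_polyMleq _ _) (leqnn k)) _.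
by rewrite [in leqRHS]addnC; apply: bound cd; rewrite ?size_poly_gt0.
Qed.

Lemma order_at_inftyM k l f g :
  order_at_infty_ge k f -> order_at_infty_ge l g ->
  order_at_infty_ge (k + l) (f * g).
Proof.
move=> [a [b [b0 -> ab]]] [c [d [d0 -> cd]]].
(* Zero numerators are set apart: 0 has size 0, one less than a nonzero constant, so the count of
   sizes over [b * d] can fall short by one. *)
have [->|a0] := eqVneq a 0; first by rewrite tofrac0 !mul0r; exact: order_at_infty0.
have [->|c0] := eqVneq c 0.
  by rewrite tofrac0 mul0r mulr0; exact: order_at_infty0.
exists (a * c), (b * d); split; first by rewrite mulf_neq0.
  by rewrite !tofracM mulf_div.
have bound x y z w :
    (0 < x -> 0 < z -> x + k <= y -> z + l <= w ->
     (x + z).-1 + (k + l) <= (y + w).-1)%N by lia.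
by rewrite !size_mul //; apply: bound ab cd; rewrite size_poly_gt0.
Qed.

Lemma order_at_inftyC (c : R) : order_at_infty_ge 0 c%:P%:F.
Proof.
exists c%:P, 1; rewrite oner_neq0 tofrac1 divr1 size_poly1 addn0.
by rewrite size_polyC_leq1.
Qed.

Lemma order_at_infty_zvarV t : order_at_infty_ge t (zvar R ^- t).
Proof.
exists 1, 'X^t; rewrite size_poly1 size_polyXn tofrac1 div1r tofracXn.
by rewrite -size_poly_eq0 size_polyXn.
Qed.

(** If [c] is nonzero, the numerator is [c] times the denominator and has the same size, which
    contradicts a gap of 1. *)
Lemma order_at_inftyC_eq0 (c : R) : order_at_infty_ge 1 c%:P%:F -> c = 0.
Proof.
move=> [a [b [b0 e ab]]]; apply/eqP; apply: contraTT ab => c0.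
have /eqP : (c%:P * b)%:F = a%:F by rewrite tofracM e divfK ?tofrac_eq0.
rewrite tofrac_eq => /eqP <-.
by rewrite mul_polyC size_scale // addn1 ltnn.
Qed.

Definition mx_order_at_infty_ge k {m n} (F : 'M[ratfun R]_(m, n)) : Prop :=
  forall i j, order_at_infty_ge k (F i j).

Lemma mx_order_at_inftyD k m n (F G : 'M[ratfun R]_(m, n)) :
  mx_order_at_infty_ge k F -> mx_order_at_infty_ge k G ->
  mx_order_at_infty_ge k (F + G).
Proof. by move=> hF hG i j; rewrite mxE; apply: order_at_inftyD. Qed.

Lemma mx_order_at_inftyM k l m n q (F : 'M[ratfun R]_(m, n))
    (G : 'M[ratfun R]_(n, q)) :
  mx_order_at_infty_ge k F -> mx_order_at_infty_ge l G ->
  mx_order_at_infty_ge (k + l) (F *m G).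
Proof.
move=> hF hG i j; rewrite mxE.
elim/big_ind: _ => [|f g|s _]; [exact: order_at_infty0|exact: order_at_inftyD|].
exact: order_at_inftyM.
Qed.

Lemma mx_order_at_infty_const m n (M : 'M[R]_(m, n)) :
  mx_order_at_infty_ge 0 (const_mat M).
Proof. by move=> i j; rewrite mxE; exact: order_at_inftyC. Qed.

(** Cofactors have size at most [n], the characteristic polynomial has size [n + 1]. *)
Lemma mx_order_at_infty_resolvent n (A : 'M[R]_n) :
  mx_order_at_infty_ge 1 (invmx (pencil A)).
Proof.
move=> i j; rewrite invmx_pencilE;
  exists (cofactor (char_poly_mx A) j i), (char_poly A).
rewrite monic_neq0 ?char_poly_monic // size_char_poly addn1 ltnS.
by split=> //; exact: size_cofactor_char_poly_mx.
Qed.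

Lemma mx_order_at_infty_transfer n m p (A : 'M[R]_n) (B : 'M[R]_(n, m))
    (C : 'M[R]_(p, n)) : mx_order_at_infty_ge 1 (transfer A B C 0).
Proof.
rewrite /transfer [const_mat 0]map_mx0 addr0.
apply: (mx_order_at_inftyM 1 0); last exact: mx_order_at_infty_const.
apply: (mx_order_at_inftyM 0 1); first exact: mx_order_at_infty_const.
exact: mx_order_at_infty_resolvent.
Qed.

Lemma mx_order_at_infty_fir_tail T q p (F : 'I_T.+1 -> 'M[R]_(q, p)) :
  mx_order_at_infty_ge 1 (fir F - const_mat (F ord0)).
Proof.
move=> i j; rewrite /fir big_ord_recl expr0 invr1 scale1r addrC addKr summxE.
elim/big_ind: _ => [|f g|t _]; [exact: order_at_infty0|exact: order_at_inftyD|].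
(* [lift ord0 t] is [t + 1], so every remaining delay has order at least 1. *)
rewrite mxE; apply: (order_at_inftyW (lift ord0 t + 0)%N) => //.
apply: order_at_inftyM; first exact: order_at_infty_zvarV.
exact: mx_order_at_infty_const.
Qed.

Lemma mx_order_at_infty_fir T q p (F : 'I_T.+1 -> 'M[R]_(q, p)) :
  mx_order_at_infty_ge 0 (fir F).
Proof.
rewrite -[fir F](subrK (const_mat (F ord0))).
apply: mx_order_at_inftyD; last exact: mx_order_at_infty_const.
by move=> i j; apply: (order_at_inftyW 1%N) => //; exact: mx_order_at_infty_fir_tail.
Qed.

(** The constant matrix [I - Y_0] equals [(fir Y - Y_0) - G fir U], a sum of two strictly proper
    terms, and a strictly proper constant vanishes. *)
Lemma fir_ord0_eq1 T m p (G : 'M[ratfun R]_(p, m)) (U : 'I_T.+1 -> 'M[R]_(m, p))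
    (Y : 'I_T.+1 -> 'M[R]_p) :
  mx_order_at_infty_ge 1 G -> fir Y - G *m fir U = 1%:M -> Y ord0 = 1%:M.
Proof.
move=> hG e; apply/eqP; rewrite eq_sym -subr_eq0; apply/eqP/matrixP => i j.
rewrite [RHS]mxE; apply: order_at_inftyC_eq0.
have strict : const_mat (1%:M - Y ord0) =
    fir Y - const_mat (Y ord0) + (- G) *m fir U.
  by rewrite addrAC mulNmx e /const_mat map_mxB map_mx1.
have := congr1 (fun F : 'M_p => F i j) strict; rewrite {1}mxE /= => ->.
apply: mx_order_at_inftyD; first exact: mx_order_at_infty_fir_tail.
apply: (mx_order_at_inftyM 1 0); last exact: mx_order_at_infty_fir.
move=> a b; rewrite mxE -mulN1r -tofrac1 -tofracN -polyCN.
by apply: (order_at_inftyM 0 1) => //; exact: order_at_inftyC.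
Qed.

End OrderAtInfinity.

(** * The chain of delays realized by the down-shift *)

Section Delays.
Context {R : realType}.
Variables (T p : nat).

Definition delay_col : 'M[ratfun R]_(\sum_(t < T) p, p) :=
  \mxcol_(t < T) ((zvar R ^- t.+1)%:M : 'M_p).

Lemma zvar_neq0 : zvar R != 0.
Proof. by rewrite tofrac_eq0 polyX_eq0. Qed.

Lemma firE q (F : 'I_T.+1 -> 'M[R]_(q, p)) :
  fir F = const_mat (F ord0) + const_mat (tail_row F) *m delay_col.
Proof.
rewrite /fir big_ord_recl expr0 invr1 scale1r; congr (_ + _).
have -> : const_mat (tail_row F) = \mxrow_(t < T) const_mat (F (lift ord0 t)).
  by apply/matrixP => i j; rewrite !mxE.
rewrite mul_mxrow_mxcol; apply: eq_bigr => t _.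
by rewrite mul_mx_scalar.
Qed.

(** In block row [i], counted from 0, multiplication by [z] gives [z^-i]. For positive [i] the shift
    brings the same block down from row [i - 1], and the two cancel; in row 0 nothing is shifted in
    and the identity remains. *)
Lemma pencil_downshift_delay_col :
  pencil (block_downshift R T p) *m delay_col = const_mat (block_e1 R T p).
Proof.
have -> : const_mat (block_e1 R T p) =
    \mxcol_(i < T) (if i == 0%N :> nat then 1%:M else 0 : 'M_p).
  apply/matrixP => i j; rewrite !mxE; case: ifP => _; rewrite !mxE //.
  by rewrite /= polyCMn tofracMn.
have cZ : const_mat (block_downshift R T p) =
    \mxblock_(i < T, j < T) (if i == j.+1 :> nat then 1%:M else 0 : 'M_p).
  apply/matrixP => i j; rewrite !mxE; case: ifP => _; rewrite !mxE //.
  by rewrite /= polyCMn tofracMn.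
rewrite /pencil mulmxBl cZ mul_mxblock_mxrow mul_scalar_mx.
have -> : zvar R *: delay_col = \mxcol_(t < T) ((zvar R ^- t)%:M : 'M_p).
  apply/matrixP => i j; rewrite !mxE mulrnAr; congr (_ *+ _).
  by rewrite exprS invfM mulrA divff ?zvar_neq0 // mul1r.
rewrite -mxcolB; apply: eq_mxcol => -[[|i] hi] /=.
  by rewrite big1 ?subr0 ?expr0 ?invr1 // => j _; rewrite mul0mx.
rewrite (bigD1 (Ordinal (ltnW hi))) //= eqxx mul1mx big1 ?addr0 ?subrr // => j.
by rewrite -val_eqE eqSS eq_sym /= => /negPf ->; rewrite mul0mx.
Qed.

End Delays.

(** * Inverse of [fir Y] and realization of the quotient *)

Section Realization.
Context {R : realType}.
Variables (T p m : nat) (U : 'I_T.+1 -> 'M[R]_(m, p)) (Y : 'I_T.+1 -> 'M[R]_p).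

Let E := block_e1 R T p.
Let M := pencil (block_downshift R T p - E *m tail_row Y).

Lemma const_matM a b c (P : 'M[R]_(a, b)) (Q : 'M[R]_(b, c)) :
  const_mat (P *m Q) = const_mat P *m const_mat Q.
Proof. exact: map_mxM. Qed.

Lemma const_matB a b (P Q : 'M[R]_(a, b)) :
  const_mat (P - Q) = const_mat P - const_mat Q.
Proof. exact: map_mxB. Qed.

Hypothesis Y0 : Y ord0 = 1%:M.

Lemma fir_monicE : fir Y = 1%:M + const_mat (tail_row Y) *m delay_col T p.
Proof. by rewrite firE Y0 [const_mat 1%:M]map_mx1. Qed.

(** The factor [fir Y] stays on the right because its invertibility is deduced from this
    identity. *)
Lemma closed_loop_delay_col : delay_col T p = invmx M *m const_mat E *m fir Y.
Proof.
rewrite -[LHS](mulKmx (pencil_unit _ _ : M \in unitmx)) -mulmxA; congr (_ *m _).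
have -> : M = pencil (block_downshift R T p) + const_mat E *m const_mat (tail_row Y).
  by rewrite /M /pencil const_matB const_matM opprB addrCA addrC.
rewrite mulmxDl pencil_downshift_delay_col fir_monicE mulmxDr mulmx1.
by rewrite mulmxA.
Qed.

(** With [V] the delay column, [(I - Yhat M^-1 E) fir Y = fir Y - Yhat V = I], and a left inverse of
    a square matrix suffices. *)
Lemma fir_monic_unit : fir Y \in unitmx.
Proof.
suff /mulmx1_unit[] :
    (1%:M - const_mat (tail_row Y) *m (invmx M *m const_mat E)) *m fir Y = 1%:M.
  by [].
rewrite mulmxBl mul1mx -[X in _ - X]mulmxA -closed_loop_delay_col.
by rewrite fir_monicE addrK.
Qed.

(** Multiplied by [fir Y] on the right, the realization becomes [U_0 (I + Yhat V) - (U_0 Yhat -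
    Uhat) V = U_0 + Uhat V], which is [fir U]. *)
Lemma fir_quotient_realization :
  fir U *m invmx (fir Y) =
  transfer (block_downshift R T p - E *m tail_row Y) (- E)
    (U ord0 *m tail_row Y - tail_row U) (U ord0).
Proof.
rewrite -[RHS](mulmxK fir_monic_unit); congr (_ *m _).
rewrite /transfer -/M mulmxDl [const_mat (- E)]map_mxN mulmxN mulNmx.
rewrite -(mulmxA (const_mat _)) -(mulmxA (const_mat _)) -closed_loop_delay_col.
rewrite fir_monicE mulmxDr mulmx1 const_matB const_matM mulmxBl opprB.
by rewrite -!mulmxA firE [X in _ = _ + X]addrC addrA subrK addrC.
Qed.

End Realization.

Theorem theorem3 (R : realType) (n m p T : nat) (hT : (1 <= T)%N)
  (A : 'M[R]_n) (B : 'M[R]_(n, m)) (C : 'M[R]_(p, n))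
  (U : 'I_T.+1 -> 'M[R]_(m, p)) (Y : 'I_T.+1 -> 'M[R]_p)
  (Phi_uy : 'M[ratfun R]_(m, p)) (Phi_yy : 'M[ratfun R]_p)
  (hU : Phi_uy = fir U) (hY : Phi_yy = fir Y)
  (hPhi : iop_constraints (transfer A B C 0) Phi_yy Phi_uy
          \/ mixed1_constraints A B C Phi_yy Phi_uy) :
  Phi_yy \in unitmx /\
  Phi_uy *m invmx Phi_yy =
    transfer (block_downshift R T p - block_e1 R T p *m tail_row Y)
             (- block_e1 R T p)
             (U ord0 *m tail_row Y - tail_row U)
             (U ord0).
Proof.
(* Both parameterizations contain this identity: it is the first block column of the left constraint
   of the input-output one, and the second block column for Mixed I. *)
have e : Phi_yy - transfer A B C 0 *m Phi_uy = 1%:M.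
  case: hPhi => [[Pyu [Puu [_ _ + _]]]|[Pyx [Pux [_ _ + _]]]];
    rewrite mul_row_block => /eq_row_mx[e1 e2].
    by rewrite -e1 mul1mx mulNmx.
  by rewrite -e2 mul1mx mulNmx.
rewrite {}hU {}hY in e *.
have Y0 := fir_ord0_eq1 _ _ _ _ _ _ (mx_order_at_infty_transfer _ _ _ A B C) e.
by split; [exact: fir_monic_unit | exact: fir_quotient_realization].
Qed.
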